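(* Consider the team setup of the multi-dimensional binary signaling problem described in the context (identical costs $C_{ji}=C^t_{ji}=C^r_{ji}$ and identical priors $\pi_i=\pi_i^t=\pi_i^r$, $i,j\in\{0,1\}$). Let $\tau\triangleq\frac{\pi_0(C_{10}-C_{00})}{\pi_1(C_{01}-C_{11})}$. If $0<\tau<\infty$, the team solution is always informative; otherwise (i.e., if $\tau\le0$ or $\tau=\infty$), there exist only non-informative equilibria.
   Context: Multi-dimensional binary signaling problem: there are two hypotheses $\mathcal H_0:\mathbf Y=\mathbf S_0+\mathbf N$ and $\mathcal H_1:\mathbf Y=\mathbf S_1+\mathbf N$, where $\mathbf Y$ takes values in $\Gamma=\mathbb R^n$, $\mathbf S_0,\mathbf S_1\in\mathbb R^n$ are deterministic signals and $\mathbf N\sim\mathcal N(\mathbf 0,\Sigma)$ with $\Sigma$ positive definite. The transmitter chooses $\mathcal S=\{\mathbf S_0,\mathbf S_1\}$ in $\mathbb S=\{\mathcal S:\|\mathbf S_0\|^2\le P_0,\ \|\mathbf S_1\|^2\le P_1\}$ (Euclidean norm), with power limits $P_0,P_1>0$. The receiver chooses a decision rule $\delta\in\Delta$, i.e. a partition of $\Gamma$ into $\Gamma_0,\Gamma_1$, deciding $\mathcal H_i$ when $\mathbf y\in\Gamma_i$ (understood up to Lebesgue-null sets). Put $\mathsf P_{ji}=\Pr(\mathbf Y\in\Gamma_j\mid\mathcal H_i)$. The priors $\pi_0,\pi_1\ge0$ satisfy $\pi_0+\pi_1=1$, and $C_{ji}\ge0$ is the cost of deciding $\mathcal H_j$ when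 $\mathcal H_i$ is true. The common Bayes risk is $$r(\mathcal S,\delta)=\pi_0(C_{00}\mathsf P_{00}+C_{10}\mathsf P_{10})+\pi_1(C_{01}\mathsf P_{01}+C_{11}\mathsf P_{11}).$$ A team solution (equilibrium) is a pair $(\mathcal S^*,\delta^* )$ minimizing $r$ over $\mathbb S\times\Delta$. $\tau$ is an extended real number: when its denominator vanishes and its numerator does not, it equals $\pm\infty$ according to the sign of the numerator. A solution/equilibrium is called non-informative (babbling) if it is achieved with a message that is useless for the receiver, i.e. $\mathbf S_0^*=\mathbf S_1^*$ and $\delta^*$ uses only the priors, or $\delta^*$ ignores the observation and always decides the same hypothesis; otherwise it is informative. *)

(* Defs.v *)
From HB Require Import structures.
From mathcomp Require Import all_boot all_order all_algebra.
From mathcomp Require Import all_classical all_reals all_analysis.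

Set Implicit Arguments.
Unset Strict Implicit.
Unset Printing Implicit Defensive.

Import Order.TTheory GRing.Theory Num.Theory.
Import numFieldNormedType.Exports.

Local Open Scope classical_set_scope.
Local Open Scope ring_scope.

(* Points of R^n that observations live in are tuples, because these carry the
   product (= Borel) sigma-algebra; signals and covariances are matrices. *)
Notation euclid R n := (n.-tuple (measurableTypeR R)).

Section lebesgue_tuple.
Context {R : realType}.

Definition cons_pair n (x : measurableTypeR R * euclid R n) : euclid R n.+1 :=
  [tuple of x.1 :: x.2].

Definition uncons_pair n (x : euclid R n.+1) : measurableTypeR R * euclid R n :=
  (tnth x ord0, [tuple of behead x]).

Lemma measurable_cons_pair n : measurable_fun [set: _] (@cons_pair n).
Proof.
exact: (@measurable_cons _ _ (measurableTypeR R * euclid R n)%type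
  (measurableTypeR R) fst n snd).
Qed.

Lemma measurable_uncons_pair n : measurable_fun [set: _] (@uncons_pair n).
Proof.
apply: measurable_fun_pair; first exact: measurable_tnth.
exact: measurable_behead.
Qed.

Lemma cons_pairK n : cancel (@cons_pair n) (@uncons_pair n).
Proof. by case=> a t; congr pair; apply/val_inj. Qed.

Definition lebesgue_cons n (m : set (euclid R n) -> \bar R) :
    set (euclid R n.+1) -> \bar R :=
  pushforward (lebesgue_measure \x m)%E (@cons_pair n).

Section lebesgue_cons_measure.
Variables (n : nat) (m : {sigma_finite_measure set (euclid R n) -> \bar R}).


Let cons0 : lebesgue_cons m set0 = 0%E.
Proof. by rewrite /lebesgue_cons /pushforward preimage_set0 measure0. Qed.

Let cons_ge0 A : (0 <= lebesgue_cons m A)%E.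
Proof. by rewrite /lebesgue_cons /pushforward; exact: measure_ge0. Qed.

Let cons_sigma_additive : semi_sigma_additive (lebesgue_cons m).
Proof.
have mf := @measurable_cons_pair n.
by rewrite /lebesgue_cons; exact: measure_semi_sigma_additive.
Qed.

HB.instance Definition _ := isMeasure.Build _ _ _ (lebesgue_cons m)
  cons0 cons_ge0 cons_sigma_additive.

Let cons_sigma_finite : sigma_finite setT (lebesgue_cons m).
Proof.
have /sigma_finiteP[F [TF ndF Foo]] := sigma_finiteT (@lebesgue_measure R).
have /sigma_finiteP[G [TG ndG Goo]] := sigma_finiteT m.
exists (fun k => @uncons_pair n @^-1` (F k `*` G k)).
  rewrite -preimage_bigcup (_ : \bigcup_k _ = setT) ?preimage_setT//.
  apply/seteqP; split=> // -[x y] _.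
  have [i _ Fx] : (\bigcup_k F k) x by rewrite -TF.
  have [j _ Gy] : (\bigcup_k G k) y by rewrite -TG.
  exists (maxn i j) => //; split.
  - by move: x Fx; exact/subsetPset/ndF/leq_maxl.
  - by move: y Gy; exact/subsetPset/ndG/leq_maxr.
move=> k; have [mF Fk] := Foo k; have [mG Gk] := Goo k; split.
  rewrite -[X in measurable X]setTI; apply: measurable_uncons_pair => //.
  exact: measurableX.
rewrite /lebesgue_cons /pushforward -comp_preimage.
rewrite (_ : _ \o _ = id) ?preimage_id; last exact/funext/cons_pairK.
by rewrite product_measure1E// lte_mul_pinfty// ge0_fin_numE.
Qed.

HB.instance Definition _ := Measure_isSigmaFinite.Build _ _ _
  (lebesgue_cons m) cons_sigma_finite.

End lebesgue_cons_measure.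

Fixpoint lebesgue_euclid n : {sigma_finite_measure set (euclid R n) -> \bar R} :=
  match n with
  | 0%N => \d_([tuple] : euclid R 0)
  | n'.+1 => lebesgue_cons (lebesgue_euclid n')
  end.

End lebesgue_tuple.

Section signaling.
Context {R : realType} {n : nat}.

Definition col_of_euclid (y : euclid R n) : 'cV[R]_n := \col_k tnth y k.

Definition posdefmx (Sigma : 'M[R]_n) : Prop :=
  Sigma^T = Sigma /\
  forall x : 'cV[R]_n, x != 0 -> 0 < (x^T *m Sigma *m x) 0 0.

Definition gaussian_pdf (Sigma : 'M[R]_n) (y : euclid R n) : R :=
  let x := col_of_euclid y in
  (Num.sqrt ((pi *+ 2) ^+ n * \det Sigma))^-1 *
  expR (- (x^T *m invmx Sigma *m x) 0 0 / 2).

(* X ~ N(0, Sigma) *)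
Definition centered_gaussian d (Omega : measurableType d)
    (Pr : probability Omega R) (X : {RV Pr >-> euclid R n})
    (Sigma : 'M[R]_n) : Prop :=
  forall A : set (euclid R n), measurable A ->
    distribution Pr X A =
    (\int[lebesgue_euclid n]_(y in A) (gaussian_pdf Sigma y)%:E)%E.

(* The hypotheses H_0 and H_1 are indexed by false and true.  A decision rule
   [delta] decides H_j on the measurable set Gamma_j = delta @^-1` [set j]. *)
Definition signals := bool -> 'cV[R]_n.
Definition decision_rule := {mfun euclid R n >-> bool}.

Definition received (s : 'cV[R]_n) (z : euclid R n) : euclid R n :=
  [tuple s k 0 + tnth z k | k < n].

Definition admissible (power : bool -> R) (S : signals) : Prop :=
  forall i, \sum_(k < n) (S i k 0) ^+ 2 <= power i.

(* In [C j i], as in P_ji, the first index is the decision and the second one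
   the true hypothesis. *)
Section team.
Context {d : measure_display} {Omega : measurableType d}.
Variables (Pr : probability Omega R) (N : {RV Pr >-> euclid R n}).
Variables (power prior : bool -> R) (C : bool -> bool -> R).

Definition decision_prob (S : signals) (delta : decision_rule) (j i : bool) : R :=
  fine (Pr [set w | delta (received (S i) (N w)) = j]).

Definition bayes_risk (S : signals) (delta : decision_rule) : R :=
  let P := decision_prob S delta in
  prior false * (C false false * P false false + C true false * P true false) +
  prior true * (C false true * P false true + C true true * P true true).

Definition team_solution (S : signals) (delta : decision_rule) : Prop :=
  admissible power S /\
  forall S' delta', admissible power S' ->
    bayes_risk S delta <= bayes_risk S' delta'.

End team.

Section informativeness.
Variables (prior : bool -> R) (C : bool -> bool -> R).

Definition prior_cost (j : bool) : R :=
  prior false * C j false + prior true * C j true.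

(* The decision is made by comparing the prior expected costs of the two
   decisions; a tie may be broken arbitrarily, also as a function of y. *)
Definition prior_based (delta : decision_rule) : Prop :=
  {ae lebesgue_euclid n, forall y,
    forall j : bool, prior_cost (delta y) <= prior_cost j}.

Definition always_decides_same (delta : decision_rule) : Prop :=
  exists j : bool, {ae lebesgue_euclid n, forall y, delta y = j}.

Definition non_informative (S : signals) (delta : decision_rule) : Prop :=
  (S false = S true /\ prior_based delta) \/ always_decides_same delta.

Definition informative (S : signals) (delta : decision_rule) : Prop :=
  ~ non_informative S delta.

End informativeness.
End signaling.

Section threshold.
Context {R : realType}.
Variables (prior : bool -> R) (C : bool -> bool -> R).

Definition tau_num : R := prior false * (C true false - C false false).
Definition tau_den : R := prior true * (C false true - C true true).

Definition tau_defined : Prop := tau_num != 0 \/ tau_den != 0.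

(* In \bar R the inverse of 0 is +oo, so that x%:E / 0 is +oo or -oo according
   to the sign of x; the junk value of 0 / 0 is excluded by [tau_defined]. *)
Definition tau : \bar R := (tau_num%:E / tau_den%:E)%E.

End threshold.

(* Main.v *)
From HB Require Import structures.
Require Import Defs.
From mathcomp Require Import all_boot all_order all_algebra.
From mathcomp Require Import all_classical all_reals all_analysis.
From mathcomp Require Import measurable_realfun ring lra.

Import Order.TTheory GRing.Theory Num.Theory.
Import numFieldNormedType.Exports.

Local Open Scope classical_set_scope.
Local Open Scope ring_scope.

(** Let [a] and [b] be the numerator and the denominator of tau.  Since
    P_0i + P_1i = 1, the Bayes risk is a constant plus the reduced cost
    [error_cost a b] = a P_10 + b P_01.  Exchanging the two decisions turns
    (a, b) into (-a, -b) up to a constant ([error_cost_flip]), so only the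
    cases a, b > 0 and a >= 0 >= b have to be studied.

    If a >= 0 >= b are not both zero, always deciding H_0 is optimal, and
    any optimal rule has P_10 = 0 or P_11 = 0.  As Gaussian densities are
    positive, it decides H_1 on a Lebesgue-null set only
    ([optimal_always_false]).

    If a, b > 0, write f_s for the density of the observation when the signal
    s is sent.  For given signals the least reduced cost is the integral of
    min (a f_{S_0}, b f_{S_1}) ([bayes_cost]).  By Fatou's lemma it is lower
    semicontinuous in the signals, and the signals range over a compact set,
    so an optimal pair exists ([optimal_exists]).  When P_10 = P_11, as for
    every non-informative pair, the reduced cost is a convex combination of a
    and b, hence at least min (a, b).  The signals 0 and s <> 0 do strictly
    better ([bayes_cost_lt_false], [bayes_cost_lt_true]): otherwise one of
    a f_0, b f_s would be almost everywhere below the other.  Multiplying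
    such an inequality by f_t and using

      f_t f_s = exp (t^T Sigma^-1 s) f_0 f_{t+s},

    then dividing by f_0 and integrating, gives a <= b exp (t^T Sigma^-1 s)
    for every t, or the reverse inequality for every t.  Both are impossible, since
    t^T Sigma^-1 s takes every real value. *)

(** * Translation invariance of Lebesgue measure on R^n *)

Lemma lebesgue_measure_shift (R : realType) (a : R)
    (A : set (measurableTypeR R)) :
  measurable A ->
  lebesgue_measure ((fun x : measurableTypeR R => a + x) @^-1` A) =
  lebesgue_measure A.
Proof.
move=> mA.
have mf : measurable_fun [set: measurableTypeR R]
    (fun x : measurableTypeR R => (a + x : measurableTypeR R)).
  by apply: measurable_funD.
apply/esym.
pose f : {mfun measurableTypeR R >-> measurableTypeR R} :=
  HB.pack (fun x : measurableTypeR R => (a + x : measurableTypeR R))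
    (isMeasurableFun.Build _ _ _ _ _ mf).
apply: (@lebesgue_measure_unique R (pushforward lebesgue_measure f)) => //.
move=> _ [[u v]] _ <-.
rewrite /= /pushforward.
have -> : f @^-1` `]u, v] = `]u - a, v - a]%classic.
  by apply/seteqP; split=> x /=; rewrite !in_itv/= lerBrDl ltrBlDl.
rewrite !lebesgue_measure_itv/= !lte_fin ltrD2r.
case: ifP => // _; by congr (_%:E); rewrite opprB addrA subrK.
Qed.

Lemma measurable_received (R : realType) n (s : 'cV[R]_n) :
  measurable_fun [set: euclid R n] (received s).
Proof.
apply/measurable_fun_tnthP => i.
rewrite (_ : _ \o _ = fun z : euclid R n => s i 0 + tnth z i); last first.
  by apply/funext => z; rewrite /= tnth_mktuple.
by apply: measurable_funD => //; exact: measurable_tnth.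
Qed.

(** [received s] is the translation by [s].  Induction on the dimension: a
    translation of R^(n+1) acts separately on the two factors of R * R^n. *)
Lemma lebesgue_euclid_received (R : realType) n (s : 'cV[R]_n)
    (A : set (euclid R n)) : measurable A ->
  lebesgue_euclid n (received s @^-1` A) = lebesgue_euclid n A.
Proof.
elim: n s A => [|n IH] s A mA.
  congr (lebesgue_euclid 0 _); apply/seteqP; split=> y /=;
  by rewrite (tuple0 y) (tuple0 (received _ _)).
pose s' : 'cV[R]_n := \col_k s (lift ord0 k) 0.
pose g (x : measurableTypeR R * euclid R n) : measurableTypeR R * euclid R n :=
  (s ord0 0 + x.1, received s' x.2).
have mg : measurable_fun setT g.
  apply: measurable_fun_pair.
    by apply: measurable_funD.
  by apply: measurableT_comp => //; exact: measurable_received.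
pose gm : {mfun (measurableTypeR R * euclid R n)%type >->
                (measurableTypeR R * euclid R n)%type} :=
  HB.pack g (isMeasurableFun.Build _ _ _ _ _ mg).
rewrite /= /lebesgue_cons /pushforward.
have mcA : measurable (@cons_pair R n @^-1` A).
  by rewrite -[X in measurable X]setTI; exact: measurable_cons_pair.
rewrite [RHS](@product_measure_unique _ _ _ _ _ _ _
  (pushforward (lebesgue_measure \x lebesgue_euclid n)%E gm)) //; last first.
  move=> B D mB mD.
  transitivity ((lebesgue_measure \x lebesgue_euclid n)%E
    ((fun x : measurableTypeR R => (s ord0 0 + x : measurableTypeR R)) @^-1` B
      `*` (received s' @^-1` D))); first by [].
  rewrite product_measure1E//=.
  - by rewrite lebesgue_measure_shift// IH.
  - rewrite -[X in measurable X]setTI; apply: measurable_funD => //.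
  - rewrite -[X in measurable X]setTI; exact: measurable_received.
have -> : @cons_pair R n @^-1` (received s @^-1` A) =
    g @^-1` (@cons_pair R n @^-1` A); last by [].
apply/funext => -[x y]; congr (A _); apply/eq_from_tnth => i.
rewrite [LHS]tnth_mktuple /cons_pair /g/=.
case: (unliftP ord0 i) => [j|] ->; last by rewrite !tnth0.
by rewrite !tnthS [RHS]tnth_mktuple mxE.
Qed.

(** * Gaussian densities of the observation *)

Lemma cvg_sum_fin (R : realType) (I : finType) (u : nat -> I -> R)
    (l : I -> R) :
  (forall i, u m i @[m --> \oo] --> l i) ->
  \sum_i u m i @[m --> \oo] --> \sum_i l i.
Proof.
move=> ul.
have addc : continuous (fun x : R * R => x.1 + x.2) by exact: add_continuous.
exact: (@cvg_big R I +%R 0 xpredT addc nat \oo (index_enum I)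
  (fun i m => u m i) l _ (fun i _ => ul i)).
Qed.

Section signal_density.
Context {R : realType} {n : nat}.
Implicit Types (Sigma : 'M[R]_n) (s t : 'cV[R]_n) (y : euclid R n).

Local Notation mu := (lebesgue_euclid n).

(** The bilinear form x^T A z of a matrix [A]. *)
Definition bilin (A : 'M[R]_n) (x z : 'cV[R]_n) : R := (x^T *m A *m z) 0 0.

Lemma bilinDl A x x' z : bilin A (x + x') z = bilin A x z + bilin A x' z.
Proof. by rewrite /bilin linearD/= !mulmxDl mxE. Qed.

Lemma bilinDr A x z z' : bilin A x (z + z') = bilin A x z + bilin A x z'.
Proof. by rewrite /bilin mulmxDr mxE. Qed.

Lemma bilinZl A a x z : bilin A (a *: x) z = a * bilin A x z.
Proof. by rewrite /bilin linearZ/= -!scalemxAl mxE. Qed.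

Lemma bilinNl A x z : bilin A (- x) z = - bilin A x z.
Proof. by rewrite -scaleN1r bilinZl mulN1r. Qed.

Lemma bilinNr A x z : bilin A x (- z) = - bilin A x z.
Proof. by rewrite /bilin mulmxN mxE. Qed.

Lemma bilin0r A x : bilin A x 0 = 0.
Proof. by rewrite /bilin mulmx0 mxE. Qed.

Lemma bilinC A x z : A^T = A -> bilin A x z = bilin A z x.
Proof.
move=> AT; rewrite /bilin -[LHS](mxE trmx_key (fun i j => (x^T *m A *m z) j i)).
by rewrite -[matrix_of_fun _ _]/((x^T *m A *m z)^T) !trmx_mul trmxK AT mulmxA.
Qed.

Lemma bilinE A x z :
  bilin A x z = \sum_j (\sum_i x i 0 * A i j) * z j 0.
Proof.
rewrite /bilin mxE; apply: eq_bigr => j _; rewrite mxE; congr (_ * _).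
by apply: eq_bigr => i _; rewrite mxE.
Qed.

Lemma posdefmx_unit Sigma : posdefmx Sigma -> Sigma \in unitmx.
Proof.
move=> [ST Spos]; rewrite -row_free_unit -kermx_eq0; apply: contraT.
move=> /rowV0Pn[v /sub_kermxP vS v0].
have /Spos : v^T != 0 by rewrite -trmx0 (inj_eq trmx_inj).
by rewrite trmxK vS mul0mx mxE ltxx.
Qed.

Lemma posdefmx_inv_gt0 Sigma s : posdefmx Sigma -> s != 0 ->
  0 < bilin (invmx Sigma) s s.
Proof.
move=> hS s0; have uS := posdefmx_unit Sigma hS; have [ST Spos] := hS.
have /Spos : invmx Sigma *m s != 0.
  apply: contra_neq s0 => /(congr1 (mulmx Sigma)).
  by rewrite mulKVmx// mulmx0.
by rewrite trmx_mul trmx_inv ST -!mulmxA (mulKVmx uS) mulmxA.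
Qed.

Lemma col_of_received s y : col_of_euclid (received s y) = s + col_of_euclid y.
Proof. by apply/colP => k; rewrite !mxE tnth_mktuple. Qed.

Lemma received_comp s t y : received s (received t y) = received (s + t) y.
Proof.
by apply: eq_from_tnth => k; rewrite !tnth_mktuple mxE addrA.
Qed.

Lemma received0 y : received 0 y = y.
Proof. by apply: eq_from_tnth => k; rewrite tnth_mktuple mxE add0r. Qed.

(** Density of s + N, where N is centered Gaussian of covariance [Sigma]. *)
Definition signal_pdf Sigma s y : R := gaussian_pdf Sigma (received (- s) y).

Lemma signal_pdfE Sigma s y : signal_pdf Sigma s y =
  (Num.sqrt ((pi *+ 2) ^+ n * \det Sigma))^-1 *
  expR (- bilin (invmx Sigma) (- s + col_of_euclid y) (- s + col_of_euclid y)
    / 2).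
Proof. by rewrite /signal_pdf /gaussian_pdf col_of_received. Qed.

Lemma signal_pdf_ge0 Sigma s y : 0 <= signal_pdf Sigma s y.
Proof. by rewrite signal_pdfE mulr_ge0 ?invr_ge0 ?expR_ge0. Qed.

(** Completing the square in the product of two translated densities. *)
Lemma signal_pdf_mul Sigma s t y : posdefmx Sigma ->
  signal_pdf Sigma t y * signal_pdf Sigma s y =
  expR (bilin (invmx Sigma) t s) *
  (signal_pdf Sigma 0 y * signal_pdf Sigma (t + s) y).
Proof.
move=> [ST _]; rewrite !signal_pdfE.
set c := (Num.sqrt _)^-1; set x := col_of_euclid y; set A := invmx Sigma.
have AT : A^T = A by rewrite trmx_inv ST.
rewrite (mulrACA c (expR _) c) (mulrACA c (expR _) c) -!expRD.
rewrite [RHS]mulrCA -expRD; congr (_ * expR _).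
rewrite oppr0 add0r opprD !(bilinDl, bilinDr, bilinNl, bilinNr).
rewrite (bilinC A s t AT) (bilinC A x t AT) (bilinC A x s AT).
by field.
Qed.

Lemma measurable_signal_pdf Sigma s :
  measurable_fun [set: euclid R n] (signal_pdf Sigma s).
Proof.
apply: measurableT_comp (measurable_received _ _ _); rewrite /gaussian_pdf.
apply: measurable_funM => //; apply: measurableT_comp => //.
apply: measurable_funM => //; apply: measurableT_comp => //.
rewrite [X in measurable_fun _ X](_ : _ = fun y : euclid R n =>
  \sum_j (\sum_i tnth y i * invmx Sigma i j) * tnth y j).
  apply: measurable_sum => j; apply: measurable_funM.
    apply: measurable_sum => i; apply: measurable_funM => //.
    exact: measurable_tnth.
  exact: measurable_tnth.
apply/funext => y; rewrite -[LHS]/(bilin _ _ _) bilinE.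
apply: eq_bigr => j _; rewrite mxE; congr (_ * _).
by apply: eq_bigr => i _; rewrite mxE.
Qed.

Lemma cvg_signal_pdf Sigma (s : 'cV[R]_n) (u : nat -> 'cV[R]_n) y :
  (forall k, u m k 0 @[m --> \oo] --> s k 0) ->
  signal_pdf Sigma (u m) y @[m --> \oo] --> signal_pdf Sigma s y.
Proof.
move=> us; rewrite signal_pdfE.
under eq_fun do rewrite signal_pdfE.
have xs k : (- u m + col_of_euclid y) k 0 @[m --> \oo] -->
    (- s + col_of_euclid y) k 0.
  under eq_fun do rewrite !mxE.
  rewrite !mxE; apply: cvgD; last exact: cvg_cst.
  exact: cvgN.
apply: cvgM; first exact: cvg_cst.
apply: continuous_cvg; first exact: continuous_expR.
apply: cvgM; last exact: cvg_cst.
apply: cvgN; under eq_fun do rewrite bilinE.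
rewrite bilinE; apply: cvg_sum_fin => j; apply: cvgM => //.
by apply: cvg_sum_fin => i; apply: cvgM => //; exact: cvg_cst.
Qed.

Lemma integral_signal_pdf Sigma s (A : set (euclid R n)) : measurable A ->
  (\int[mu]_(y in A) (signal_pdf Sigma s y)%:E =
   \int[mu]_(y in received s @^-1` A) (gaussian_pdf Sigma y)%:E)%E.
Proof.
move=> mA.
transitivity (\int[pushforward mu (received s)]_(y in A)
    (signal_pdf Sigma s y)%:E)%E.
  apply: eq_measure_integral; first exact: measurable_received.
  move=> ms B mB _.
  exact/esym/lebesgue_euclid_received.
rewrite ge0_integral_pushforward.
- apply: eq_integral => y _ /=.
  by rewrite /signal_pdf received_comp addNr received0.
- exact: measurable_received.
- exact: mA.
- apply: measurable_funTS; apply/measurable_EFinP.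
  exact: measurable_signal_pdf.
- by move=> y _; rewrite lee_fin signal_pdf_ge0.
Qed.

End signal_density.

(** * Decision probabilities and the reduced cost *)

Section team_risk.
Context {R : realType} {n : nat}.
Context {d : measure_display} {Omega : measurableType d}.
Context {Pr : probability Omega R} {Sigma : 'M[R]_n}.
Variable N : {RV Pr >-> euclid R n}.
Hypothesis hN : centered_gaussian N Sigma.
Implicit Types (S : @signals R n) (delta : @decision_rule R n).
Implicit Types (s t : 'cV[R]_n) (y : euclid R n).

Local Notation mu := (lebesgue_euclid n).
Local Notation pdf := (signal_pdf Sigma).
Local Notation prob := (decision_prob N).

Lemma integral_signal_pdfT s : (\int[mu]_y (pdf s y)%:E = 1)%E.
Proof.
rewrite integral_signal_pdf// preimage_setT -hN//.
exact: probability_setT.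
Qed.

(** The normalizing constant cannot vanish, because the density integrates to
    1; no computation of the determinant is needed. *)
Lemma signal_pdf_gt0 s y : 0 < pdf s y.
Proof.
rewrite signal_pdfE mulr_gt0 ?expR_gt0// lt_neqAle invr_ge0 sqrtr_ge0 andbT.
apply/negP => /eqP c0.
have := integral_signal_pdfT s; rewrite integral0_eq => [/eqP|x _].
  by rewrite eq_sym onee_eq0.
by rewrite signal_pdfE -c0 mul0r.
Qed.

Lemma measurable_decision delta j : measurable (delta @^-1` [set j]).
Proof. by rewrite -[X in measurable X]setTI; exact: measurable_funP. Qed.

Lemma decision_event_measurable S delta j i :
  measurable [set w | delta (received (S i) (N w)) = j].
Proof.
rewrite (_ : [set w | _] =
  N @^-1` (received (S i) @^-1` (delta @^-1` [set j])))//.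
rewrite -[X in measurable X]setTI; apply: measurable_funP => //.
rewrite -[X in measurable X]setTI; apply: measurable_received => //.
exact: measurable_decision.
Qed.

Lemma decision_probE S delta j i : ((prob S delta j i)%:E =
  \int[mu]_(y in delta @^-1` [set j]) (pdf (S i) y)%:E)%E.
Proof.
rewrite integral_signal_pdf; last exact: measurable_decision.
rewrite -hN; last first.
  rewrite -[X in measurable X]setTI; apply: measurable_received => //.
  exact: measurable_decision.
rewrite /decision_prob fineK// fin_num_measure//.
exact: decision_event_measurable.
Qed.

Lemma decision_prob_ge0 S delta j i : 0 <= prob S delta j i.
Proof. by rewrite /decision_prob fine_ge0. Qed.

Lemma decision_probC S delta i : prob S delta false i = 1 - prob S delta true i.
Proof.
have mT := decision_event_measurable S delta true i.
rewrite /decision_prob (_ : [set w | _ = false] =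
    ~` [set w | delta (received (S i) (N w)) = true]); last first.
  by apply/seteqP; split=> w /=; case: (delta _).
by rewrite probability_setC// fineB// fin_num_measure.
Qed.

(** Deciding [j] has probability zero exactly when it happens on a Lebesgue-null
    set of observations, because the densities are positive. *)
Lemma decision_prob_eq0 S delta j i : prob S delta j i = 0 <->
  {ae mu, forall y, delta y = ~~ j}.
Proof.
have mD := measurable_decision delta j.
have mf : measurable_fun (delta @^-1` [set j]) (fun y => (pdf (S i) y)%:E).
  apply: measurable_funTS; apply/measurable_EFinP.
  exact: measurable_signal_pdf.
have E : (\int[mu]_(y in delta @^-1` [set j]) `|(pdf (S i) y)%:E| =
          (prob S delta j i)%:E)%E.
  rewrite decision_probE; apply: eq_integral => y _.
  by rewrite gee0_abs// lee_fin signal_pdf_ge0.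
have H := ae_eq_integral_abs mu mD mf; rewrite E in H; split.
- move=> P0; have /H : (prob S delta j i)%:E = 0%E by rewrite P0.
  apply: filterS => y /= dy.
  have [/dy[f0]|] := eqVneq (delta y) j; last by case: (delta y); case: (j).
  by have := signal_pdf_gt0 (S i) y; rewrite f0 ltxx.
- move=> D; suff : (prob S delta j i)%:E = 0%E by case.
  apply/H; move: D; apply: filterS => y dy /= dyj.
  by move: dy; rewrite dyj; case: (j).
Qed.

(** The part a P_10 + b P_01 of the Bayes risk that depends on the signals
    and on the decision rule. *)
Definition error_cost (a b : R) S delta : R :=
  a * prob S delta true false + b * prob S delta false true.

(** [S] and [delta] minimize [error_cost a b] under the power limits; the
    team solutions are the case of [a], [b] the two terms of tau. *)
Definition optimal (power : bool -> R) (a b : R) S delta :=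
  admissible power S /\ forall S' delta', admissible power S' ->
    error_cost a b S delta <= error_cost a b S' delta'.

Lemma error_costE a b S delta : 0 <= a -> 0 <= b ->
  ((error_cost a b S delta)%:E = \int[mu]_y
    (if delta y then a * pdf (S false) y else b * pdf (S true) y)%:E)%E.
Proof.
move=> a0 b0.
have mu1 s : measurable_fun [set: euclid R n] (fun y => pdf s y).
  exact: measurable_signal_pdf.
have mD j := measurable_decision delta j.
have TE : [set: euclid R n] =
    delta @^-1` [set true] `|` delta @^-1` [set false].
  by apply/seteqP; split=> y //= _; case: (delta y); [left|right].
rewrite [in RHS]TE ge0_integral_setU//; first last.
- rewrite disj_set2E; apply/eqP/seteqP; split=> y //= -[-> //].
- move=> y _; rewrite lee_fin.
  by case: ifP => _; rewrite mulr_ge0// signal_pdf_ge0.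
- rewrite -TE; apply/measurable_EFinP; apply: measurable_fun_ifT => //.
  + by apply: measurable_funM.
  + by apply: measurable_funM.
rewrite /error_cost EFinD !EFinM !decision_probE.
rewrite -!ge0_integralZl_EFin//;
  do ?[by move=> y _; rewrite lee_fin signal_pdf_ge0];
  do ?[by apply: measurable_funTS; apply/measurable_EFinP].
by congr (_ + _)%E; apply: eq_integral => y; rewrite inE/= => ->.
Qed.

(** The least value of [error_cost a b S] over the decision rules, when
    [a] and [b] are nonnegative. *)
Definition bayes_cost (a b : R) S : \bar R :=
  (\int[mu]_y (Num.min (a * pdf (S false) y) (b * pdf (S true) y))%:E)%E.

Lemma measurable_bayes_cost a b S : measurable_fun [set: euclid R n]
  (fun y => (Num.min (a * pdf (S false) y) (b * pdf (S true) y))%:E).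
Proof.
apply/measurable_EFinP; apply: measurable_minr; apply: measurable_funM => //;
exact: measurable_signal_pdf.
Qed.

Lemma bayes_cost_le a b S delta : 0 <= a -> 0 <= b ->
  (bayes_cost a b S <= (error_cost a b S delta)%:E)%E.
Proof.
move=> a0 b0; rewrite error_costE//; apply: ge0_le_integral => //.
- by move=> y _; rewrite lee_fin le_min !mulr_ge0// signal_pdf_ge0.
- exact: measurable_bayes_cost.
- apply/measurable_EFinP; apply: measurable_fun_ifT => //;
  apply: measurable_funM => //; exact: measurable_signal_pdf.
- by move=> y _; rewrite lee_fin; case: ifP => _; rewrite ge_min lexx// orbT.
Qed.

(** The likelihood ratio test attains the pointwise minimum. *)
Lemma bayes_cost_attained a b S : 0 <= a -> 0 <= b ->
  exists delta, (error_cost a b S delta)%:E = bayes_cost a b S.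
Proof.
move=> a0 b0.
have mD : measurable_fun [set: euclid R n]
    (fun y => a * pdf (S false) y < b * pdf (S true) y).
  apply: measurable_fun_ltr; apply: measurable_funM => //;
  exact: measurable_signal_pdf.
pose delta : {mfun euclid R n >-> bool} :=
  HB.pack (fun y => a * pdf (S false) y < b * pdf (S true) y)
    (isMeasurableFun.Build _ _ _ _ _ mD).
by exists delta; rewrite error_costE//; apply: eq_integral => y _.
Qed.

End team_risk.

(** * Existence of an optimal pair *)

(** Bolzano-Weierstrass for bounded families indexed by a finite type, which
    are encoded as row vectors.  The indices [g m] of the extracted family are
    only required to be at least [m]. *)
Lemma bounded_seq_cvg_subseq (R : realType) (I : finType) (M : R)
    (u : nat -> I -> R) : (forall m i, `|u m i| <= M) ->
  exists (p : I -> R) (g : nat -> nat), (forall m, (m <= g m)%N) /\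
    forall i, u (g m) i @[m --> \oo] --> p i.
Proof.
move=> uM.
pose v m : 'rV[R]_#|I| := \row_k u m (enum_val k).
have cK : compact [set w : 'rV[R]_#|I| | forall k, w ord0 k \in `[(- M), M]].
  apply: (@rV_compact _ _ (fun=> `[(- M), M]%classic)) => _.
  exact: segment_compact.
have FK : (v @ \oo)
    [set w : 'rV[R]_#|I| | forall k, w ord0 k \in `[(- M), M]].
  by exists 0%N => // m _ k; rewrite mxE in_itv/= -ler_norml.
have [q [_ cq]] := cK _ _ FK.
have /choice[g gP] : forall m : nat, exists k, (m <= k)%N /\
    forall i, `|q ord0 (enum_rank i) - u k i| < m.+1%:R^-1.
  move=> m.
  have e0 : (0 : R) < m.+1%:R^-1 by rewrite invr_gt0.
  have Fm : (v @ \oo) (v @` [set k | (m <= k)%N]).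
    by exists m => // k /= mk; exists k.
  have [w [[k mk <-]]] := cq _ _ Fm (nbhsx_ballx q _ e0).
  move=> qv; exists k; split=> // i; case: qv => _ /(_ ord0 (enum_rank i)).
  by rewrite /ball/= mxE enum_rankK.
exists (fun i => q ord0 (enum_rank i)), g; split=> [m|i]; first by case: (gP m).
apply/cvgrPdist_lt => e e0.
near=> m; have [_ /(_ i)/lt_trans] := gP m; apply.
near: m; exact: (near_infty_natSinv_lt (PosNum e0)).
Unshelve. all: by end_near. Qed.

Lemma cvg_minr (R : realType) (f g : nat -> R) (a b : R) :
  f m @[m --> \oo] --> a -> g m @[m --> \oo] --> b ->
  Num.min (f m) (g m) @[m --> \oo] --> Num.min a b.
Proof.
move=> fa gb; under eq_fun do rewrite minr_absE.
rewrite minr_absE; apply: cvgM; last exact: cvg_cst.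
by apply: cvgB; [exact: cvgD|apply: cvg_norm; exact: cvgB].
Qed.

Lemma limn_einf_le_cvg (R : realType) (u v : nat -> \bar R) (l : \bar R) :
  (forall m, u m <= v m)%E -> v m @[m --> \oo] --> l -> (limn_einf u <= l)%E.
Proof.
move=> uv vl; rewrite limn_einf_lim -(cvg_lim _ vl)//.
apply: lee_lim; [exact: is_cvg_einfs|by apply/cvg_ex; exists l|].
apply: nearW => m; apply: le_trans (uv m).
by apply: ereal_inf_lbound; exists m => /=.
Qed.

Section existence.
Context {R : realType} {n : nat}.
Context {d : measure_display} {Omega : measurableType d}.
Context {Pr : probability Omega R} {Sigma : 'M[R]_n}.
Variable N : {RV Pr >-> euclid R n}.
Hypothesis hN : centered_gaussian N Sigma.
Implicit Types (S : @signals R n) (delta : @decision_rule R n).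

Local Notation cost := (bayes_cost (Sigma := Sigma)).

(** Lower semicontinuity of the minimal reduced cost in the signals. *)
Lemma bayes_cost_lsc a b S (u : nat -> signals) (v : nat -> \bar R) l :
  0 <= a -> 0 <= b ->
  (forall i k, u m i k 0 @[m --> \oo] --> S i k 0) ->
  (forall m, cost a b (u m) <= v m)%E -> v m @[m --> \oo] --> l ->
  (cost a b S <= l)%E.
Proof.
move=> a0 b0 uS uv vl.
pose f m y := (Num.min (a * signal_pdf Sigma (u m false) y)
                       (b * signal_pdf Sigma (u m true) y))%:E.
have fS y : f m y @[m --> \oo] -->
  (Num.min (a * signal_pdf Sigma (S false) y)
           (b * signal_pdf Sigma (S true) y))%:E.
  apply: cvg_EFin; first exact: nearW.
  by apply: cvg_minr; (apply: cvgM; [exact: cvg_cst|exact: cvg_signal_pdf]).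
apply: le_trans (limn_einf_le_cvg _ _ _ _ uv vl).
have f0 m y : (0 <= f m y)%E.
  by rewrite lee_fin le_min !mulr_ge0// signal_pdf_ge0.
have := @fatou _ _ R (lebesgue_euclid n) setT measurableT f
  (fun m => measurable_bayes_cost a b (u m)) (fun m y _ => f0 m y).
apply: le_trans; rewrite le_eqVlt; apply/orP; left; apply/eqP.
apply: eq_integral => y _; rewrite is_cvg_limn_einfE.
  by apply/esym/cvg_lim => //; exact: fS.
by apply/cvg_ex; eexists; exact: fS.
Qed.

Lemma bayes_cost_fineK a b S : 0 <= a -> 0 <= b ->
  (fine (cost a b S))%:E = cost a b S.
Proof.
by move=> a0 b0; have [delta <-] := bayes_cost_attained N hN a b S a0 b0.
Qed.

Lemma sqr_le_norm_le (x P : R) : x ^+ 2 <= P -> `|x| <= 1 + P.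
Proof.
move=> xP; have := sqr_ge0 (`|x| - 1); rewrite sqrrB.
rewrite real_normK ?num_real// => H; have := normr_ge0 x; nra.
Qed.

(** A limit point of a minimizing sequence of signals, with its likelihood
    ratio test, is optimal. *)
Lemma optimal_exists (power : bool -> R) a b : (forall i, 0 < power i) ->
  0 <= a -> 0 <= b -> exists S delta, optimal N power a b S delta.
Proof.
move=> hp a0 b0.
pose V S := fine (cost a b S).
have VE S : (V S)%:E = cost a b S by exact: bayes_cost_fineK.
have Vle S delta : V S <= error_cost N a b S delta.
  by rewrite -lee_fin VE; exact: bayes_cost_le.
have V0 S : 0 <= V S.
  rewrite -lee_fin VE; apply: integral_ge0 => y _.
  by rewrite lee_fin le_min !mulr_ge0// signal_pdf_ge0.
pose E := V @` [set S | admissible power S].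
have Einf : has_inf E.
  split; last by exists 0 => _ [S _ <-].
  exists (V (fun=> 0)), (fun=> 0) => // i /=.
  by rewrite big1 ?ltW// => k _; rewrite mxE expr0n.
have /choice[u uP] : forall m : nat, exists S, admissible power S /\
    V S < inf E + m.+1%:R^-1.
  move=> m; have e0 : (0 : R) < m.+1%:R^-1 by rewrite invr_gt0.
  by have [_ [S aS <-] VS] := inf_adherent e0 Einf; exists S.
have uM m (ik : bool * 'I_n) :
    `|u m ik.1 ik.2 0| <= 1 + (power false + power true).
  case: ik => i k /=; apply: sqr_le_norm_le.
  apply: (@le_trans _ _ (power i)); last first.
    by case: i; rewrite ?lerDl ?lerDr ltW.
  have [/(_ i) + _] := uP m; apply: le_trans.
  by rewrite (bigD1 k)//= lerDl sumr_ge0// => j _; exact: sqr_ge0.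
have [p [g [gm up]]] := bounded_seq_cvg_subseq _ _ _
  (fun m ik => u m ik.1 ik.2 0) uM.
pose S : @signals R n := fun i => \col_k p (i, k).
have uS i k : u (g m) i k 0 @[m --> \oo] --> S i k 0.
  by rewrite mxE; exact: (up (i, k)).
have aS : admissible power S.
  move=> i; have uS2 : \sum_k u (g m) i k 0 ^+ 2 @[m --> \oo] -->
      \sum_k S i k 0 ^+ 2.
    apply: cvg_sum_fin => k; rewrite expr2; under eq_fun do rewrite expr2.
    exact: cvgM.
  apply: (cvgr_to_le uS2).
  by apply: nearW => m; have [/(_ i)] := uP (g m).
have VS : V S <= inf E.
  rewrite -lee_fin VE.
  apply: (bayes_cost_lsc a b S (u \o g)
    (fun m => (inf E + m.+1%:R^-1)%:E)) => //.
    move=> m /=; rewrite -VE lee_fin; have [_ /ltW/le_trans] := uP (g m); apply.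
    by rewrite lerD2l lef_pV2 ?posrE// ler_nat ltnS.
  apply: cvg_EFin; first exact: nearW.
  rewrite -[X in _ --> X]addr0; apply: cvgD; first exact: cvg_cst.
  exact: cvg_harmonic.
have [delta dE] := bayes_cost_attained N hN a b S a0 b0.
exists S, delta; split=> // S' delta' aS'.
apply: le_trans (Vle S' delta').
have -> : error_cost N a b S delta = V S by rewrite /V -dE.
apply: (le_trans VS); apply: ge_inf; last by exists S'.
by exists 0 => _ [? _ <-].
Qed.

End existence.

(** * Strict benefit of distinct signals *)

Lemma ae_eq_of_integral_le (R : realType) d (T : measurableType d)
    (mu : {measure set T -> \bar R}) (u v : T -> R) :
  measurable_fun setT u -> measurable_fun setT v ->
  (forall x, 0 <= u x <= v x) ->
  (\int[mu]_x (v x)%:E <= \int[mu]_x (u x)%:E < +oo)%E ->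
  {ae mu, forall x, u x = v x}.
Proof.
move=> mfu mfv uv /andP[vu ufin].
have u0 x : (0 <= (u x)%:E)%E by rewrite lee_fin; case/andP: (uv x).
have w0 x : (0 <= (v x - u x)%:E)%E
  by rewrite lee_fin subr_ge0; case/andP: (uv x).
have mw : measurable_fun setT (fun x => (v x - u x)%:E).
  by apply/measurable_EFinP; exact: measurable_funB.
have vE : (\int[mu]_x (v x)%:E =
    \int[mu]_x (u x)%:E + \int[mu]_x (v x - u x)%:E)%E.
  rewrite -ge0_integralD//; last by apply/measurable_EFinP.
  by apply: eq_integral => x _; rewrite -EFinD addrC subrK.
have ufn : (\int[mu]_x (u x)%:E)%E \is a fin_num.
  by rewrite ge0_fin_numE// integral_ge0.
have w_eq0 : (\int[mu]_x `|(v x - u x)%:E| = 0)%E.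
  under eq_integral do rewrite gee0_abs//.
  apply/eqP; rewrite eq_le integral_ge0// andbT.
  by rewrite -(leeD2lE _ _ ufn) adde0 -vE.
have := (ae_eq_integral_abs mu measurableT mw).1 w_eq0.
by apply: filterS => x /(_ I) [] /eqP; rewrite subr_eq0 => /eqP.
Qed.

Section strict.
Context {R : realType} {n : nat}.
Context {d : measure_display} {Omega : measurableType d}.
Context {Pr : probability Omega R} {Sigma : 'M[R]_n}.
Variable N : {RV Pr >-> euclid R n}.
Hypothesis hS : posdefmx Sigma.
Hypothesis hN : centered_gaussian N Sigma.
Implicit Types (S : @signals R n) (delta : @decision_rule R n).
Implicit Types (s t : 'cV[R]_n) (y : euclid R n).
Local Notation mu := (lebesgue_euclid n).
Local Notation pdf := (signal_pdf Sigma).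
Local Notation cost := (bayes_cost (Sigma := Sigma)).

Lemma integral_scaled_pdf c s : 0 <= c ->
  (\int[mu]_y (c * pdf s y)%:E = c%:E)%E.
Proof.
move=> c0; under eq_integral do rewrite EFinM.
rewrite ge0_integralZl_EFin//.
- by rewrite (integral_signal_pdfT N hN) mule1.
- by move=> y _; rewrite lee_fin signal_pdf_ge0.
- by apply/measurable_EFinP; exact: measurable_signal_pdf.
Qed.

Lemma measurable_scaled_pdf c s :
  measurable_fun [set: euclid R n] (fun y => (c * pdf s y)%:E).
Proof.
apply/measurable_EFinP; apply: measurable_funM => //.
exact: measurable_signal_pdf.
Qed.

(** An almost everywhere comparison of two densities is tilted by [t]:
    multiply it by f_t, complete the square, divide by f_0 and integrate. *)
Lemma ae_pdf_le_tilt a b r s t : 0 <= a -> 0 <= b ->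
  {ae mu, forall y, a * pdf r y <= b * pdf s y} ->
  a * expR (bilin (invmx Sigma) t r) <= b * expR (bilin (invmx Sigma) t s).
Proof.
move=> a0 b0 ab; set er := expR (bilin _ t r); set es := expR (bilin _ t s).
have ar0 : 0 <= a * er by rewrite mulr_ge0 ?expR_ge0.
have bs0 : 0 <= b * es by rewrite mulr_ge0 ?expR_ge0.
rewrite -lee_fin -(integral_scaled_pdf _ (t + r) ar0).
rewrite -(integral_scaled_pdf _ (t + s) bs0).
apply: ae_ge0_le_integral => //; do ?[exact: measurable_scaled_pdf];
  do ?[by move=> y _; rewrite lee_fin mulr_ge0// signal_pdf_ge0].
apply: filterS ab => y ab _; rewrite lee_fin.
have f0 := signal_pdf_gt0 N hN 0 y; have ft := signal_pdf_gt0 N hN t y.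
have E c v : pdf 0 y * (c * expR (bilin (invmx Sigma) t v) * pdf (t + v) y) =
    c * pdf v y * pdf t y.
  by rewrite -[RHS]mulrA [pdf v y * _]mulrC signal_pdf_mul//; ring.
by rewrite -(ler_pM2l f0) !E ler_pM2r.
Qed.

(** The signals 0 under H_0 and [s] under H_1. *)
Definition zero_or s : @signals R n := fun i => if i then s else 0.

Lemma bilin_onto s (x : R) : s != 0 -> exists t, bilin (invmx Sigma) t s = x.
Proof.
move=> s0; exists ((x / bilin (invmx Sigma) s s) *: s).
by rewrite bilinZl divfK// gt_eqF// posdefmx_inv_gt0.
Qed.

Lemma bayes_cost_lt_false a b s : 0 < a -> 0 < b -> s != 0 ->
  (cost a b (zero_or s) < a%:E)%E.
Proof.
move=> a0 b0 s0; rewrite ltNge; apply/negP => a_le.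
have bfin : (cost a b (zero_or s) < +oo)%E.
  by rewrite -(bayes_cost_fineK N hN) ?ltry// ltW.
have ab : {ae mu, forall y, a * pdf 0 y <= b * pdf s y}.
  have : {ae mu, forall y, Num.min (a * pdf 0 y) (b * pdf s y) = a * pdf 0 y}.
    apply: ae_eq_of_integral_le.
    - apply/measurable_EFinP.
      exact: (measurable_bayes_cost a b (zero_or s)).
    - by apply/measurable_EFinP; exact: measurable_scaled_pdf.
    - by move=> y; rewrite ge_min lexx le_min !mulr_ge0 ?signal_pdf_ge0//;
        exact: ltW.
    - by rewrite (integral_scaled_pdf a 0 (ltW a0)); apply/andP; split.
  by apply: filterS => y <-; rewrite ge_min lexx orbT.
(* With this exponent the tilted inequality reads a <= a / 2. *)
have [t tE] := bilin_onto s (ln (a / (2 * b))) s0.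
have := ae_pdf_le_tilt a b 0 s t (ltW a0) (ltW b0) ab.
rewrite bilin0r expR0 mulr1 tE lnK ?posrE ?divr_gt0 ?mulr_gt0//.
have -> : b * (a / (2 * b)) = a / 2 by field; rewrite gt_eqF.
lra.
Qed.

Lemma bayes_cost_lt_true a b s : 0 < a -> 0 < b -> s != 0 ->
  (cost a b (zero_or s) < b%:E)%E.
Proof.
move=> a0 b0 s0; rewrite ltNge; apply/negP => b_le.
have bfin : (cost a b (zero_or s) < +oo)%E.
  by rewrite -(bayes_cost_fineK N hN) ?ltry// ltW.
have ab : {ae mu, forall y, b * pdf s y <= a * pdf 0 y}.
  have : {ae mu, forall y, Num.min (a * pdf 0 y) (b * pdf s y) = b * pdf s y}.
    apply: ae_eq_of_integral_le.
    - apply/measurable_EFinP.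
      exact: (measurable_bayes_cost a b (zero_or s)).
    - by apply/measurable_EFinP; exact: measurable_scaled_pdf.
    - by move=> y; rewrite ge_min lexx orbT le_min !mulr_ge0 ?signal_pdf_ge0//;
        exact: ltW.
    - by rewrite (integral_scaled_pdf b s (ltW b0)); apply/andP; split.
  by apply: filterS => y <-; rewrite ge_min lexx.
(* With this exponent the tilted inequality reads 2 a <= a. *)
have [t tE] := bilin_onto s (ln (2 * a / b)) s0.
have := ae_pdf_le_tilt b a s 0 t (ltW b0) (ltW a0) ab.
rewrite bilin0r expR0 mulr1 tE lnK ?posrE ?divr_gt0 ?mulr_gt0//.
have -> : b * (2 * a / b) = 2 * a by field; rewrite gt_eqF.
lra.
Qed.

(** Non-informative pairs cannot be optimal when [a, b > 0], since their
    reduced cost is at least the minimum of [a] and [b]. *)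
Lemma exists_error_cost_lt_min (power : bool -> R) a b : (0 < n)%N ->
  (forall i, 0 < power i) -> 0 < a -> 0 < b ->
  exists S delta, admissible power S /\ error_cost N a b S delta < Num.min a b.
Proof.
move=> n0 hp a0 b0.
pose s : 'cV[R]_n := Num.sqrt (power true) *: delta_mx (Ordinal n0) 0.
have s0 : s != 0.
  apply/eqP => /colP/(_ (Ordinal n0)); rewrite !mxE !eqxx mulr1 => /eqP.
  by rewrite gt_eqF// sqrtr_gt0.
have [delta dE] := bayes_cost_attained N hN a b (zero_or s) (ltW a0) (ltW b0).
exists (zero_or s), delta; split.
  case; last by rewrite big1 ?ltW// => k _; rewrite mxE expr0n.
  rewrite (bigD1 (Ordinal n0))//= !mxE !eqxx mulr1 sqr_sqrtr; last exact: ltW.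
  by rewrite big1 ?addr0// => k kn; rewrite !mxE (negbTE kn) mulr0 expr0n.
rewrite -lte_fin dE EFin_min lt_min.
by rewrite bayes_cost_lt_false// bayes_cost_lt_true.
Qed.

End strict.

(** * Non-informative pairs and costs of opposite signs *)

Section assembly.
Context {R : realType} {n : nat}.
Context {d : measure_display} {Omega : measurableType d}.
Context {Pr : probability Omega R} {Sigma : 'M[R]_n}.
Variable N : {RV Pr >-> euclid R n}.
Hypothesis hN : centered_gaussian N Sigma.
Implicit Types (S : @signals R n) (delta : @decision_rule R n).
Implicit Types (power prior : bool -> R) (C : bool -> bool -> R).
Local Notation mu := (lebesgue_euclid n).

Lemma measurable_flip delta :
  measurable_fun [set: euclid R n] (fun y => ~~ delta y).
Proof. exact: (@measurableT_comp _ _ _ _ _ _ negb). Qed.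

(** The decision rule that takes the opposite decision. *)
Definition flip delta : decision_rule :=
  HB.pack (fun y => ~~ delta y)
    (isMeasurableFun.Build _ _ _ _ _ (measurable_flip delta)).

Lemma decision_prob_flip S delta j i :
  decision_prob N S (flip delta) j i = decision_prob N S delta (~~ j) i.
Proof.
rewrite /decision_prob; congr (fine (Pr _)).
by apply/seteqP; split=> w /=; case: (delta _) j => -[].
Qed.

Lemma error_cost_flip a b S delta : error_cost N a b S (flip delta) =
  a + b + error_cost N (- a) (- b) S delta.
Proof.
rewrite /error_cost !decision_prob_flip/= decision_probC.
by have := decision_probC N S delta true => ->; ring.
Qed.

Lemma optimal_flip power a b S delta : optimal N power a b S delta ->
  optimal N power (- a) (- b) S (flip delta).
Proof.
move=> [aS opt]; split=> // S' delta' aS'.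
rewrite error_cost_flip !opprK.
have := opt S' (flip delta') aS'; rewrite error_cost_flip; lra.
Qed.

Lemma bayes_riskE prior C S delta : bayes_risk N prior C S delta =
  prior false * C false false + prior true * C true true +
  error_cost N (tau_num prior C) (tau_den prior C) S delta.
Proof.
rewrite /bayes_risk /error_cost /tau_num /tau_den.
have -> := decision_probC N S delta false.
by have -> := decision_probC N S delta true; ring.
Qed.

Lemma team_solutionE power prior C S delta :
  team_solution N power prior C S delta <->
  optimal N power (tau_num prior C) (tau_den prior C) S delta.
Proof.
by split=> -[aS opt]; split=> // S' delta' aS'; have := opt S' delta' aS';
  rewrite !bayes_riskE lerD2l.
Qed.

(** Under a non-informative pair the law of the decision does not depend on
    the true hypothesis. *)
Lemma non_informative_prob prior C S delta : non_informative prior C S delta ->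
  decision_prob N S delta true false = decision_prob N S delta true true.
Proof.
move=> [[SE _]|[j dj]]; first by rewrite /decision_prob SE.
have P0 i : decision_prob N S delta (~~ j) i = 0.
  by apply/(decision_prob_eq0 N hN); rewrite negbK.
case: j {dj} P0 => /= P0; last by rewrite !P0.
have := P0 false; have := P0 true; rewrite !decision_probC; lra.
Qed.

Lemma error_cost_uninformative a b S delta :
  decision_prob N S delta true false = decision_prob N S delta true true ->
  Num.min a b <= error_cost N a b S delta.
Proof.
move=> PE; rewrite /error_cost decision_probC PE.
have p0 := decision_prob_ge0 N S delta true true.
have := decision_prob_ge0 N S delta false true; rewrite decision_probC.
set p := decision_prob _ _ _ _ _ in p0 * => p1.
by have [ab|ba] := leP a b; nra.
Qed.

(** The sign conditions say that, under either hypothesis, deciding H_1 costs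
    at least as much as deciding H_0, and strictly more under one of them. *)
Lemma optimal_always_false power a b S delta :
  0 <= a -> b <= 0 -> (a != 0) || (b != 0) ->
  optimal N power a b S delta -> {ae mu, forall y, delta y = false}.
Proof.
move=> a0 b0 ab0 [aS opt].
have := opt S (cst false) aS; rewrite /error_cost.
have F i : decision_prob N S (cst false) true i = 0.
  by apply/(decision_prob_eq0 N hN); apply: aeW.
rewrite !decision_probC !F => H.
have p0 := decision_prob_ge0 N S delta true false.
have q0 := decision_prob_ge0 N S delta true true.
have aP : 0 <= a * decision_prob N S delta true false by rewrite mulr_ge0.
have bP : 0 <= - b * decision_prob N S delta true true.
  by rewrite mulr_ge0// oppr_ge0.
case/orP: ab0 => [an0|bn0].
- apply/(decision_prob_eq0 N hN S delta true false).
  suff : a * decision_prob N S delta true false = 0.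
    by move/eqP; rewrite mulf_eq0 (negbTE an0) => /eqP.
  by lra.
- apply/(decision_prob_eq0 N hN S delta true true).
  suff : b * decision_prob N S delta true true = 0.
    by move/eqP; rewrite mulf_eq0 (negbTE bn0) => /eqP.
  by lra.
Qed.

Lemma optimal_const_false power a b : (forall i, 0 < power i) ->
  0 <= a -> b <= 0 -> optimal N power a b (fun=> 0) (cst false).
Proof.
move=> hp a0 b0; split.
  by move=> i; rewrite big1 ?ltW// => k _; rewrite mxE expr0n.
move=> S' delta' _; rewrite /error_cost !decision_probC.
have F i : decision_prob N (fun=> 0) (cst false) true i = 0.
  by apply/(decision_prob_eq0 N hN); apply: aeW.
rewrite !F.
have p0 := decision_prob_ge0 N S' delta' true false.
have q0 := decision_prob_ge0 N S' delta' true true.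
nra.
Qed.

End assembly.

(** * Signs of the two terms of tau *)

Lemma tau_pos_cases (R : realType) (prior : bool -> R) C :
  (0 < tau prior C < +oo)%E ->
  (0 < tau_num prior C /\ 0 < tau_den prior C) \/
  (tau_num prior C < 0 /\ tau_den prior C < 0).
Proof.
rewrite /tau; move: (tau_num _ _) (tau_den _ _) => a b.
have [->|b0] := eqVneq b 0.
  rewrite inve0; have [a0|a0|->] := ltgtP a 0.
  - by rewrite lt0_muley ?lte_fin.
  - by rewrite gt0_muley ?lte_fin// ltxx andbF.
  - by rewrite mul0e lte_fin ltxx.
rewrite inver (negbTE b0) -EFinM lte_fin => /andP[ab _].
have [bn|bp] := ltP b 0; [right|left].
  by split=> //; move: ab; rewrite nmulr_lgt0// invr_lt0.
have {}bp : 0 < b by rewrite lt_neqAle eq_sym b0.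
by split=> //; move: ab; rewrite pmulr_lgt0// invr_gt0.
Qed.

Lemma tau_nonpos_cases (R : realType) (prior : bool -> R) C :
  (tau prior C <= 0)%E \/ tau prior C = +oo%E ->
  (0 <= tau_num prior C /\ tau_den prior C <= 0) \/
  (tau_num prior C <= 0 /\ 0 <= tau_den prior C).
Proof.
rewrite /tau; move: (tau_num _ _) (tau_den _ _) => a b.
have [->|b0] := eqVneq b 0.
  by move=> _; have [a0|a0] := leP a 0; [right|left; split=> //; exact: ltW].
rewrite inver (negbTE b0) -EFinM lee_fin => -[ab|//].
have [bn|bp] := ltP b 0; [left|right]; split=> //.
- by move: ab; rewrite nmulr_lle0// invr_lt0.
- exact: ltW.
- by move: ab; rewrite pmulr_lle0// invr_gt0 lt_neqAle eq_sym b0.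
Qed.

(** * Informative and non-informative team solutions *)

Theorem theorem5p1 (R : realType) (n : nat) (hn : (0 < n)%N)
    (d : measure_display) (Omega : measurableType d) (Pr : probability Omega R)
    (Sigma : 'M[R]_n) (hSigma : posdefmx Sigma)
    (N : {RV Pr >-> euclid R n}) (hN : centered_gaussian N Sigma)
    (power : bool -> R) (hpower : forall i, 0 < power i)
    (prior : bool -> R) (hprior : forall i, 0 <= prior i)
    (hprior1 : prior false + prior true = 1)
    (C : bool -> bool -> R) (hC : forall j i, 0 <= C j i)
    (htau : tau_defined prior C) :
  ((0 < tau prior C < +oo)%E ->
    (exists (S : signals) (delta : decision_rule),
      team_solution N power prior C S delta) /\
    (forall (S : signals) (delta : decision_rule),
      team_solution N power prior C S delta ->
      informative prior C S delta)) /\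
  ((tau prior C <= 0)%E \/ tau prior C = +oo%E ->
    (exists (S : signals) (delta : decision_rule),
      team_solution N power prior C S delta) /\
    (forall (S : signals) (delta : decision_rule),
      team_solution N power prior C S delta ->
      non_informative prior C S delta)).
Proof.
set a := tau_num prior C; set b := tau_den prior C.
have informative_of a' b' S delta : 0 < a' -> 0 < b' ->
    optimal N power a' b' S delta ->
    decision_prob N S delta true false <> decision_prob N S delta true true.
  move=> a0 b0 [_ opt] PE.
  have [S' [delta' [aS']]] :=
    exists_error_cost_lt_min N hSigma hN power a' b' hn hpower a0 b0.
  rewrite ltNge => /negP; apply.
  by apply: le_trans (opt _ _ aS'); exact: error_cost_uninformative.
split=> [/tau_pos_cases|/tau_nonpos_cases]; rewrite -/a -/b => cases.
  split.
    case: cases => -[a0 b0].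
      have [S [delta opt]] :=
        optimal_exists N hN power a b hpower (ltW a0) (ltW b0).
      by exists S, delta; apply/team_solutionE.
    have [||S [delta opt]] := optimal_exists N hN power (- a) (- b) hpower.
    - by rewrite oppr_ge0 ltW.
    - by rewrite oppr_ge0 ltW.
    exists S, (flip delta); apply/team_solutionE.
    by have := optimal_flip N _ _ _ _ _ opt; rewrite !opprK.
  move=> S delta /team_solutionE opt /(non_informative_prob N hN) PE.
  case: cases => -[a0 b0]; first exact: informative_of a0 b0 opt PE.
  have a0' : 0 < - a by rewrite oppr_gt0.
  have b0' : 0 < - b by rewrite oppr_gt0.
  apply: (informative_of _ _ _ _ a0' b0' (optimal_flip N _ _ _ _ _ opt)).
  by rewrite !decision_prob_flip/= !decision_probC PE.
have ab0 : (a != 0) || (b != 0) by apply/orP; exact: htau.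
case: cases => -[a0 b0].
  split.
    have opt := optimal_const_false N hN power a b hpower a0 b0.
    by exists (fun=> 0); eexists; apply/team_solutionE; exact: opt.
  move=> S delta /team_solutionE opt; right; exists false.
  exact: (optimal_always_false N hN _ _ _ _ _ a0 b0 ab0 opt).
have a0' : 0 <= - a by rewrite oppr_ge0.
have b0' : - b <= 0 by rewrite oppr_le0.
split.
  have := optimal_flip N _ _ _ _ _
    (optimal_const_false N hN power _ _ hpower a0' b0').
  rewrite !opprK => opt.
  by exists (fun=> 0); eexists; apply/team_solutionE; exact: opt.
move=> S delta /team_solutionE opt; right; exists true.
have := optimal_always_false N hN _ _ _ _ _ a0' b0' _
  (optimal_flip N _ _ _ _ _ opt).
rewrite !oppr_eq0 => /(_ ab0).
by apply: filterS => y /=; case: (delta y).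
Qed.
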